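(* Fix $D_1,D_2\in[1,\infty)$. Let $(X,d)$ be a metric space and $U_1,U_2\subseteq X$. Assume that $(U_1,d)$ embeds with distortion $D_1$ into an ultrametric space and that $(U_2,d)$ embeds with distortion $D_2$ into an ultrametric space. Then the metric space $(U_1\cup U_2,d)$ embeds with distortion at most $(D_1+2)(D_2+2)-2$ into an ultrametric space.
   Context: An ultrametric space is a metric space $(U,\rho)$ satisfying $\rho(x,y)\le\max\{\rho(x,z),\rho(y,z)\}$ for all $x,y,z\in U$. For $D\in[1,\infty)$, a metric space $(S,d)$ embeds with distortion $D$ into an ultrametric space if there exist an ultrametric space $(U,\rho)$ and an injection $f:S\to U$ with $d(x,y)\le\rho(f(x),f(y))\le D\,d(x,y)$ for all $x,y\in S$. Subsets of $X$ carry the restriction of $d$. *)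

(* Defs.v *)
From HB Require Import structures.
From mathcomp Require Import all_boot all_order all_algebra.
From mathcomp Require Import all_classical reals topology.

Set Implicit Arguments.
Unset Strict Implicit.
Unset Printing Implicit Defensive.

Import Order.TTheory GRing.Theory Num.Theory.

Local Open Scope classical_set_scope.
Local Open Scope ring_scope.

Section subset_metric.
Context {R : realType} {X : metricType R} (A : set X).

Let sub_mdist (x y : set_type A) : R := mdist (val x) (val y).

Let sub_mdist_ge0 x y : 0 <= sub_mdist x y.
Proof. exact: mdist_ge0. Qed.

Let sub_mdist_positivity x y : sub_mdist x y = 0 -> x = y.
Proof. by move/mdist_positivity/val_inj. Qed.

Let sub_ballEmdist (x : set_type A) d :
  ball x d = [set y | sub_mdist x y < d].
Proof.
by apply/seteqP; split=> y; rewrite /ball /= /initial_ball ballEmdist.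
Qed.

HB.instance Definition _ := PseudoMetric_isMetric.Build R (set_type A)
  sub_mdist_ge0 sub_mdist_positivity sub_ballEmdist.

End subset_metric.

Lemma mdist_set_type (R : realType) (X : metricType R) (A : set X)
  (x y : set_type A) : mdist x y = mdist (val x) (val y).
Proof. by []. Qed.

Definition ultrametric (R : realType) (V : metricType R) : Prop :=
  forall x y z : V, mdist x y <= Num.max (mdist x z) (mdist y z).

Definition embeds_in_ultrametric (R : realType) (D : R) (S : metricType R) :
    Prop :=
  exists (V : metricType R) (f : S -> V),
    [/\ ultrametric V, injective f &
        forall x y : S, mdist x y <= mdist (f x) (f y) <= D * mdist x y].

(* Main.v *)
Require Import Defs.
From HB Require Import structures.
From mathcomp Require Import all_boot all_order all_algebra.
From mathcomp Require Import lra.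
From mathcomp Require Import all_classical reals topology.

(** A set embeds with distortion [D] into an ultrametric space iff the endpoints
of every chain in it with steps at most [t] are at distance at most [D * t]; the
ultrametric is then [D] times the least step size of a chain between two points.
In a chain in [U1 `|` U2] with steps at most [t], each excursion into [U1] moves
by at most [D1 * t], so skipping the excursions gives a chain in [U2] with steps
at most [(D1 + 2) * t].  Its endpoints are at most [D2 * (D1 + 2) * t] apart, and
the initial and final excursions into [U1] add at most [(D1 + 1) * t] each; the
total is [((D1 + 2) * (D2 + 2) - 2) * t]. *)

Import Order.TTheory GRing.Theory Num.Theory.

Local Open Scope classical_set_scope.
Local Open Scope ring_scope.

Inductive linked {R : realType} {X : metricType R} (A : set X) (t : R) :
    X -> X -> Prop :=
| linked_refl x of A x : linked A t x x
| linked_step x y z of A x & mdist x y <= t & linked A t y z : linked A t x z.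
Arguments linked_refl {R X A t x}.
Arguments linked_step {R X A t x y z}.

Section linked.
Context {R : realType} {X : metricType R}.
Implicit Types (A : set X) (t : R) (x y z : X).

Lemma linked_mem {A t x y} : linked A t x y -> A x /\ A y.
Proof. by elim=> [//|{}x y' z Ax _ _ [_ Az]]. Qed.

Lemma linked_trans {A t x y z} :
  linked A t x y -> linked A t y z -> linked A t x z.
Proof.
by elim=> [//|{}x y' w Ax xy' _ IH /IH]; exact: linked_step xy'.
Qed.

Lemma linked_rcons {A t x y z} :
  linked A t x y -> mdist y z <= t -> A z -> linked A t x z.
Proof.
move=> xy yz Az; apply: (linked_trans xy).
by apply: linked_step yz (linked_refl Az); case: (linked_mem xy).
Qed.

Lemma linked_sym {A t x y} : linked A t x y -> linked A t y x.
Proof.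
elim=> [z Az|{}x y' z Ax xy' _ IH]; first exact: linked_refl.
by apply: linked_rcons IH _ Ax; rewrite metric_sym.
Qed.

Lemma le_linked {A t t' x y} : t <= t' -> linked A t x y -> linked A t' x y.
Proof.
move=> tt'; elim=> [z Az|{}x y' z Ax xy' _ IH]; first exact: linked_refl.
exact: linked_step (le_trans xy' tt') IH.
Qed.

End linked.

(** [set_type A] already carries the restricted metric, so a new distance on it has to live on a
    copy [V]. *)
Lemma exists_metricType {R : realType} {T : choiceType} (rho : T -> T -> R) :
    (forall x, rho x x = 0) -> (forall x y, rho x y = 0 -> x = y) ->
    (forall x y, rho x y = rho y x) ->
    (forall y x z, rho x z <= rho x y + rho y z) ->
  exists (V : metricType R) (f : T -> V),
    bijective f /\ forall x y, mdist (f x) (f y) = rho x y.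
Proof.
(* [isMetric.Build] does not unify with a variable [T : choiceType]. *)
case: T rho => T cT rho rhoxx rho_eq0 rho_sym rho_tri.
pose T' : choiceType := HB.pack T cT.
pose m := isMetric.Build R T' rhoxx rho_eq0 rho_sym rho_tri.
pose V : metricType R := HB.pack T cT m.
by exists V, id; split; [exists id|].
Qed.

(** Maxima replace sums along the chain, so its length does not matter; [0 <= t] covers the
    one-point chain. *)
Lemma ultrametric_linked (R : realType) (V : metricType R) (t : R) (x y : V) :
  ultrametric V -> 0 <= t -> linked setT t x y -> mdist x y <= t.
Proof.
move=> umV t0; elim=> [z _|{}x y' z _ xy' _ y'z]; first by rewrite mdistxx.
by apply: le_trans (umV x z y') _; rewrite ge_max xy' metric_sym.
Qed.

Section linking_distance.
Context {R : realType} {X : metricType R} (A : set X).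
Implicit Types x y z : set_type A.

(** A point is linked to itself for every real [t], so [0 <= t] keeps the set bounded below when
    [x = y]. *)
Let steps x y := [set t | 0 <= t /\ linked A t (val x) (val y)].

(** The subdominant (single-linkage) pseudo-ultrametric of [A]: the largest one below [mdist]. *)
Definition linking_dist x y : R := inf (steps x y).

Let memA x : A (val x). Proof. exact: set_valP. Qed.

Let steps_mdist x y : steps x y (mdist x y).
Proof.
split; first exact: mdist_ge0.
exact: linked_step (memA x) (lexx _) (linked_refl (memA y)).
Qed.

Let steps_neq0 x y : steps x y !=set0.
Proof. by exists (mdist x y). Qed.

Let linking_dist_le x y t : steps x y t -> linking_dist x y <= t.
Proof. by apply: ge_inf; exists 0 => ? []. Qed.

Lemma linking_dist_le_mdist x y : linking_dist x y <= mdist x y.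
Proof. exact: linking_dist_le. Qed.

Lemma linking_dist_sym x y : linking_dist x y = linking_dist y x.
Proof.
by congr inf; apply/seteqP; split=> t [t0 /linked_sym].
Qed.

Lemma linking_dist_ultra x y z :
  linking_dist x y <= Num.max (linking_dist x z) (linking_dist y z).
Proof.
rewrite leNgt gt_max; apply/negP => /andP[].
(* Otherwise there are [s] and [t] below [linking_dist x y]; the chains joined at [z] have steps at
   most their maximum. *)
move=> /(inf_lt (steps_neq0 _ _))[s [s0 xz] s_lt].
move=> /(inf_lt (steps_neq0 _ _))[t [t0 yz] t_lt].
have : linking_dist x y <= Num.max s t.
  apply: linking_dist_le; split; first by rewrite le_max s0.
  apply: (linked_trans (le_linked _ xz)); first by rewrite le_max lexx.
  by apply: le_linked (linked_sym yz); rewrite le_max lexx orbT.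
by rewrite leNgt gt_max s_lt t_lt.
Qed.

Lemma le_linking_dist (D : R) x y : 0 < D ->
    (forall t, 0 <= t -> linked A t (val x) (val y) -> mdist x y <= D * t) ->
  mdist x y <= D * linking_dist x y.
Proof.
move=> D0 xyD; rewrite -ler_pdivrMl//; apply: lb_le_inf => // t [t0 xy].
by rewrite ler_pdivrMl//; exact: xyD.
Qed.

End linking_distance.

Lemma embeds_in_ultrametricP (R : realType) (D : R) (X : metricType R)
    (A : set X) : 0 < D ->
  embeds_in_ultrametric D (set_type A) <->
  forall t x y, 0 <= t -> linked A t x y -> mdist x y <= D * t.
Proof.
move=> D0; split=> [[V [f [umV _ fD]]] t x y t0 xy|AD].
  have [Ax Ay] := linked_mem xy.
  have Dt0 : 0 <= D * t by rewrite mulr_ge0// ltW.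
  (* The image of the chain under [f] has steps at most [D * t], and [V] is ultrametric. *)
  suff fxy : linked setT (D * t) (f (exist _ x (mem_set Ax)))
                                 (f (exist _ y (mem_set Ay))).
    have /andP[] := fD (exist _ x (mem_set Ax)) (exist _ y (mem_set Ay)).
    by move=> + _; move=> /le_trans; apply; exact: ultrametric_linked.
  elim: xy Ax Ay => [z Az Az' Az''|{}x y' z Ax xy' y'z IH Ax' Az].
    by rewrite (Prop_irrelevance Az' Az''); exact: linked_refl.
  have [Ay' _] := linked_mem y'z.
  apply: linked_step (IH Ay' Az) => //.
  have /andP[_] := fD (exist _ x (mem_set Ax')) (exist _ y' (mem_set Ay')).
  by move=> /le_trans; apply; rewrite ler_pM2l.
pose rho (x y : set_type A) := D * linking_dist A x y.
(* These two bounds also yield metric axioms: the lower one gives nonnegativity and separation, the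
   upper one [rho x x = 0]. *)
have rho_ge x y : mdist x y <= rho x y.
  by apply: le_linking_dist => // t; exact: AD.
have rho_le x y : rho x y <= D * mdist x y.
  by rewrite ler_pM2l//; exact: linking_dist_le_mdist.
have rho0 x y : 0 <= rho x y by apply: le_trans (rho_ge x y); exact: mdist_ge0.
have rhoxx x : rho x x = 0.
  by apply/eqP; rewrite eq_le rho0 (le_trans (rho_le x x))// mdistxx mulr0.
have rho_eq0 x y : rho x y = 0 -> x = y.
  move=> xy0; apply: mdist_positivity; apply/eqP.
  by rewrite eq_le mdist_ge0 -xy0 rho_ge.
have rho_sym x y : rho x y = rho y x by rewrite /rho linking_dist_sym.
have rho_ultra x y z : rho x y <= Num.max (rho x z) (rho y z).
  by rewrite /rho -maxr_pMr ?(ltW D0)// ler_pM2l//; exact: linking_dist_ultra.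
have rho_tri y x z : rho x z <= rho x y + rho y z.
  apply: le_trans (rho_ultra x z y) _.
  by rewrite ge_max lerDl rho0 rho_sym lerDr rho0.
have [V [f [[g fK gK] fE]]] :=
  exists_metricType rho rhoxx rho_eq0 rho_sym rho_tri.
exists V, f; split=> [x y z||x y]; last by rewrite fE rho_ge rho_le.
  by rewrite -[x]gK -[y]gK -[z]gK !fE.
exact: can_inj fK.
Qed.

Lemma linked_setU (R : realType) (X : metricType R) (U1 U2 : set X) (D1 t : R)
    (x y : X) : 0 <= D1 -> 0 <= t ->
    (forall a b, linked U1 t a b -> mdist a b <= D1 * t) ->
    linked (U1 `|` U2) t x y ->
  linked U1 t x y \/
  exists u v, [/\ mdist x u <= (D1 + 1) * t, linked U2 ((D1 + 2) * t) u v &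
                  mdist y v <= (D1 + 1) * t].
Proof.
move=> D10 t0 U1D1.
have D1t0 : 0 <= D1 * t by rewrite mulr_ge0.
(* The induction carries the excursion itself, as a chain in [U1]: a mere bound on [mdist x u] would
   grow by [t] with each new point. *)
pose near x u := u = x \/ exists2 w, linked U1 t x w & mdist w u <= t.
have near_le a u : near a u -> mdist a u <= (D1 + 1) * t.
  case=> [->|[w aw wu]]; first by rewrite mdistxx; lra.
  by have := metric_triangle a w u; have := U1D1 _ _ aw; lra.
have near_step z a u : U1 z -> U2 u -> mdist z a <= t -> near a u -> near z u.
  move=> U1z U2u za [->|[w aw wu]]; right.
    by exists z => //; exact: linked_refl.
  by exists w => //; exact: linked_step za aw.
suff near_link : linked (U1 `|` U2) t x y -> linked U1 t x y \/
    exists u v, [/\ near x u, linked U2 ((D1 + 2) * t) u v & near y v].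
  move=> /near_link[|[u [v [/near_le xu uv /near_le yv]]]]; first by left.
  by right; exists u, v.
elim=> [z [U1z|U2z]|{}x x' z [U1x|U2x] xx' _ [x'z|[u [v [x'u uv zv]]]]].
- by left; exact: linked_refl.
- by right; exists z, z; split; [left|exact: linked_refl|left].
- by left; exact: linked_step x'z.
- by right; exists u, v; split=> //; apply: near_step x'u; case: (linked_mem uv).
(* From [x'] on the chain stays in [U1]: this is the final excursion, reversed to start at [z], and
   [u = v = x]. *)
- right; exists x, x; split; [by left|exact: linked_refl|].
  by right; exists x'; [exact: linked_sym|rewrite metric_sym].
- right; exists x, v; split; [by left| |by []].
  apply: linked_step uv => //.
  (* One step to [x'], then at most [(D1 + 1) * t] to [u]: hence the constant [D1 + 2]. *)
  by have := metric_triangle x x' u; have := near_le _ _ x'u; lra.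
Qed.

Theorem theorem1p4 (R : realType) (D1 D2 : R) (hD1 : 1 <= D1) (hD2 : 1 <= D2)
    (X : metricType R) (U1 U2 : set X) :
  embeds_in_ultrametric D1 (set_type U1) ->
  embeds_in_ultrametric D2 (set_type U2) ->
  exists2 D : R, 1 <= D <= (D1 + 2) * (D2 + 2) - 2 &
    embeds_in_ultrametric D (set_type (U1 `|` U2)).
Proof.
have D10 : 0 <= D1 by lra.
have D20 : 0 <= D2 by lra.
move=> /embeds_in_ultrametricP U1D1 /embeds_in_ultrametricP U2D2.
exists ((D1 + 2) * (D2 + 2) - 2); first by rewrite lexx andbT; nra.
apply/embeds_in_ultrametricP; first by nra.
move=> t x y t0 xy.
(* Signs of the monomials, which [lra] treats as atoms. *)
have D1t0 : 0 <= D1 * t by rewrite mulr_ge0.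
have D2t0 : 0 <= D2 * t by rewrite mulr_ge0.
have D1D2t0 : 0 <= D1 * (D2 * t) by rewrite mulr_ge0.
have {}U1D1 a b : linked U1 t a b -> mdist a b <= D1 * t.
  by apply: U1D1 => //; lra.
have [/U1D1|[u [v [xu uv yv]]]] := linked_setU _ _ _ _ _ _ _ _ D10 t0 U1D1 xy.
  by lra.
have uvD : mdist u v <= D2 * ((D1 + 2) * t).
  by apply: U2D2 uv; [lra|rewrite mulr_ge0//; lra].
(* The three pieces add up to [2 * (D1 + 1) + D2 * (D1 + 2) = (D1 + 2) * (D2 + 2) - 2], times
   [t]. *)
have := metric_triangle x u y; have := metric_triangle u v y.
by rewrite (metric_sym v y); lra.
Qed.
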